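(* Let $1<\beta<2$. Then there is no $\alpha\in S$ such that for all $x\in[M^-,M^+]$ the digit sequence for $x$ generated by $R_{\beta,\alpha}$ gives the negative greedy $\beta$-expansion of $x$ with digits in $\{0,1\}$.
   Context: For $1<\beta<2$ put $M^-=\frac{-\beta}{\beta^2-1}$, $M^+=\frac{1}{\beta^2-1}$, and $S=\big[\frac{1}{\beta^2-1}-\frac1\beta,\,-\frac{1}{\beta(\beta^2-1)}\big]\subset[M^-,M^+]$. For $\alpha\in S$ define $R=R_{\beta,\alpha}:[M^-,M^+]\to[M^-,M^+]$ by $Rx=-\beta x-1$ if $x<\alpha$ and $Rx=-\beta x$ if $x\ge\alpha$. The digit sequence of $x\in[M^-,M^+]$ generated by $R$ is $b_1(x)b_2(x)\cdots$, where for $n\ge1$, $b_n(x)=0$ if $R^{n-1}x\ge\alpha$ and $b_n(x)=1$ if $R^{n-1}x<\alpha$; it satisfies $x=\sum_{k=1}^\infty(-1)^k\frac{b_k(x)}{\beta^k}$. Alternate ordering on $\{0,1\}^{\mathbb N}$: $b_1b_2\cdots\prec d_1d_2\cdots$ if and only if there is an $n\ge1$ such that $b_k=d_k$ for all $1\le k\le n-1$ and $(-1)^n(b_n-d_n)<0$; and $b\preceq d$ means $b=d$ or $b\prec d$. An expansion $x=\sum_{k=1}^\infty(-1)^k\frac{b_k}{\beta^k}$ with $b=b_1b_2\cdots\in\{0,1\}^{\mathbb N}$ is the negative greedy $\beta$-expansion of $x$ with digits in $\{0,1\}$ if for each sequence $d=d_1d_2\cdots\in\{0,1\}^{\mathbb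 N}$ with $x=\sum_{k=1}^\infty(-1)^k\frac{d_k}{\beta^k}$ we have $d\preceq b$.
   Formalization: The endpoints of S are printed in reverse order, making S empty for 1<β<2; here S is taken as [−1/(β(β²−1)), 1/(β²−1) − 1/β], exactly the α for which R_{β,α} maps [M⁻,M⁺] to itself. *)

(* Defs.v *)
From mathcomp Require Import all_boot all_order all_algebra.
From mathcomp Require Import all_classical all_reals all_analysis.
From mathcomp Require Import ring lra.

Set Implicit Arguments.
Unset Strict Implicit.
Unset Printing Implicit Defensive.

Import Order.TTheory GRing.Theory Num.Theory.
Import numFieldNormedType.Exports.

Local Open Scope classical_set_scope.
Local Open Scope ring_scope.

Definition Mminus (R : realType) (beta : R) : R := - beta / (beta ^+ 2 - 1).

Definition Mplus (R : realType) (beta : R) : R := 1 / (beta ^+ 2 - 1).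

Definition S_lo (R : realType) (beta : R) : R :=
  - (1 / (beta * (beta ^+ 2 - 1))).

Definition S_hi (R : realType) (beta : R) : R :=
  1 / (beta ^+ 2 - 1) - 1 / beta.

(* The source prints this interval with its endpoints in the opposite order,
   [S_hi, S_lo].  Since S_lo < S_hi when 1 < beta < 2 (lemma S_lo_lt_hi), that
   order, read literally, gives the empty set.  S_lo <= alpha <= S_hi is the
   condition under which the transformation maps [M^-, M^+] into itself (lemma
   negT_stable). *)
Definition Sset (R : realType) (beta : R) : interval R :=
  `[S_lo beta, S_hi beta].

(* The map R_{beta,alpha}, extended by the same formula to all reals. *)
Definition negT (R : realType) (beta alpha x : R) : R :=
  if x < alpha then - beta * x - 1 else - beta * x.

(* Digit sequences b_1 b_2 ... are functions nat -> bool indexed from 0: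
   [b n] is the digit b_{n+1}, with true standing for 1 and false for 0. *)
Definition digits (R : realType) (beta alpha x : R) : nat -> bool :=
  fun n => iter n (negT beta alpha) x < alpha.

Definition neg_expansion (R : realType) (beta x : R) (b : nat -> bool) : Prop :=
  series (fun n => (-1) ^+ n.+1 * ((b n)%:R / beta ^+ n.+1)) @ \oo --> x.

Definition alt_lt (b d : nat -> bool) : Prop :=
  exists n : nat, (forall k, (k < n)%N -> b k = d k) /\
    (-1) ^+ n.+1 * ((b n)%:Z - (d n)%:Z) < 0 :> int.

Definition alt_le (b d : nat -> bool) : Prop := b = d \/ alt_lt b d.

Definition neg_greedy_expansion (R : realType) (beta x : R)
    (b : nat -> bool) : Prop :=
  neg_expansion beta x b /\
  forall d : nat -> bool, neg_expansion beta x d -> alt_le d b.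

Lemma S_lo_lt_hi (R : realType) (beta : R) :
  1 < beta < 2 -> S_lo beta < S_hi beta.
Proof.
move=> /andP[b1 b2].
have D : 0 < beta * (beta ^+ 2 - 1) by nra.
rewrite -subr_gt0.
have -> : S_hi beta - S_lo beta =
    ((2 - beta) * (1 + beta)) / (beta * (beta ^+ 2 - 1)).
  by rewrite /S_hi /S_lo; field; apply/andP; split; apply: lt0r_neq0; nra.
by apply: divr_gt0 => //; nra.
Qed.

Lemma negT_stable (R : realType) (beta alpha x : R) :
  1 < beta < 2 -> alpha \in Sset beta ->
  x \in `[Mminus beta, Mplus beta] ->
  negT beta alpha x \in `[Mminus beta, Mplus beta].
Proof.
move=> /andP[b1 b2]; rewrite !in_itv /= => /andP[lo hi] /andP[xlo xhi].
have D0 : beta ^+ 2 - 1 != 0 by apply: lt0r_neq0; nra.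
have b0 : beta != 0 by apply: lt0r_neq0; lra.
have e1 : beta * S_lo beta = - Mplus beta.
  by rewrite /S_lo /Mplus; field; rewrite D0 b0.
have e2 : beta * S_hi beta = - Mminus beta - 1.
  by rewrite /S_hi /Mminus; field; rewrite D0 b0.
have e3 : beta * Mminus beta = - Mplus beta - 1.
  by rewrite /Mminus /Mplus; field.
have e4 : beta * Mplus beta = - Mminus beta.
  by rewrite /Mminus /Mplus; field.
by rewrite /negT; case: ltP => ax; apply/andP; split; nra.
Qed.

(* Main.v *)
Require Import Defs.
From mathcomp Require Import all_boot all_order all_algebra.
From mathcomp Require Import all_classical all_reals all_analysis.
From mathcomp Require Import ring lra.

Import Order.TTheory GRing.Theory Num.Theory.
Import numFieldNormedType.Exports.
Local Open Scope classical_set_scope.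
Local Open Scope ring_scope.

(** In the alternate order, a larger digit makes a sequence smaller at an odd
    position and larger at an even one.  The greedy expansion therefore takes
    the digit 0 whenever possible at odd positions, and the digit 1 whenever
    possible at even positions.  The map R applies the same rule at every
    position, and on the overlap [S_lo, S_hi], where both digits are possible,
    no threshold serves both parities.

    If S_lo < alpha, then R gives the digit 1 to S_lo, although S_lo also has
    an expansion starting with 0, since - beta * S_lo = M^+.  So the threshold
    would have to be S_lo, by the first digit alone.  But then R gives the
    digits 00 to x = - S_hi / beta, whose image S_hi is above S_lo.  Since
    - beta * S_hi - 1 = M^-, S_hi also has an expansion starting with 1, and so
    x has one starting with 01, which is larger.

    The expansions of M^+ and M^- that are needed after these first digits are
    those which R is assumed to generate; [neg_expansion_cons] prepends digits
    to them, and [alt_lt_not_ge] turns a comparison at the first differing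
    digit into a violation of greediness. *)

Definition scons (c : bool) (b : nat -> bool) : nat -> bool :=
  fun n => if n is m.+1 then b m else c.

(** Removing the first term of the series and multiplying by [- beta] gives
    the series of the tail: this is the map x |-> - beta x - c that defines R,
    read backwards. *)
Lemma neg_expansion_cons (R : realType) (beta x : R) (c : bool)
    (b : nat -> bool) : beta != 0 ->
  neg_expansion beta (- beta * x - c%:R) b -> neg_expansion beta x (scons c b).
Proof.
move=> b0 eb; rewrite /neg_expansion -(cvg_shiftS (series _)).
have -> : x = - (c%:R / beta) - beta^-1 * (- beta * x - c%:R) by field.
rewrite [X in X @ \oo --> _](_ : _ = fun n => - (c%:R / beta) - beta^-1 *
    series (fun n => (-1) ^+ n.+1 * ((b n)%:R / beta ^+ n.+1)) n); last first.
  apply/funext => n /=; rewrite /series /= big_nat_recl//= !expr1 mulN1r.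
  rewrite mulr_sumr -sumrN; congr (_ + _); apply: eq_bigr => i _.
  by rewrite (exprS _ i.+1) (exprS beta i.+1); field; rewrite b0 expf_neq0.
by apply: cvgB; [exact: cvg_cst | exact: cvgMl_tmp].
Qed.

Lemma alt_lt_not_ge (b d : nat -> bool) : alt_lt b d -> ~ alt_le d b.
Proof.
move=> [n [eqn ltn]] [dEb|[m [eqm ltm]]].
  by move: ltn; rewrite dEb subrr mulr0 ltxx.
have [nm|mn|nm] := ltngtP n m.
- by move: ltn; rewrite eqm// subrr mulr0 ltxx.
- by move: ltm; rewrite eqn// subrr mulr0 ltxx.
- by move: ltn; rewrite -opprB mulrN oppr_lt0 nm => /lt_trans/(_ ltm); rewrite ltxx.
Qed.

Theorem proposition3p1 (R : realType) (beta : R) (hbeta : 1 < beta < 2) :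
  ~ exists alpha : R, alpha \in Sset beta /\
      forall x : R, x \in `[Mminus beta, Mplus beta] ->
        neg_greedy_expansion beta x (digits beta alpha x).
Proof.
move=> [alpha [aS greedy]].
have /andP[b1 b2] := hbeta.
have D0 : beta ^+ 2 - 1 != 0 by apply: lt0r_neq0; nra.
have b0 : beta != 0 by apply: lt0r_neq0; lra.
have lohi := S_lo_lt_hi hbeta.
have e1 : beta * S_lo beta = - Mplus beta.
  by rewrite /S_lo /Mplus; field; rewrite D0 b0.
have e2 : beta * S_hi beta = - Mminus beta - 1.
  by rewrite /S_hi /Mminus; field; rewrite D0 b0.
have e4 : beta * Mplus beta = - Mminus beta.
  by rewrite /Mminus /Mplus; field.
have Mp : 0 < Mplus beta by rewrite divr_gt0//; nra.
have hiMp : S_hi beta < Mplus beta.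
  by rewrite /S_hi ltrBlDr ltrDl divr_gt0//; lra.
have loMm : Mminus beta < S_lo beta.
  have b_gt0 : 0 < beta by lra.
  by rewrite -(ltr_pM2l b_gt0) e1; nra.
have expand y : y \in `[Mminus beta, Mplus beta] ->
    neg_expansion beta y (digits beta alpha y) by move=> /greedy[].
move: aS; rewrite in_itv /= le_eqVlt => /andP[/orP[/eqP lo|lo] _].
- (* The point whose image under R is the upper end of the overlap. *)
  set x := - (S_hi beta / beta).
  have bx : - beta * x = S_hi beta by rewrite /x; field.
  have [_] : neg_greedy_expansion beta x (digits beta alpha x).
    by apply: greedy; rewrite in_itv /=; apply/andP; split; nra.
  move/(_ (scons false (scons true (digits beta alpha (Mminus beta))))).
  have xlo : x < alpha = false by apply/negbTE; rewrite -leNgt -lo; nra.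
  move=> H; apply: (alt_lt_not_ge _ _ _ (H _)); last first.
    do 2 apply: neg_expansion_cons => //.
    rewrite subr0 bx mulNr e2 opprB opprK addrAC subrr add0r.
    by apply: expand; rewrite in_itv /=; apply/andP; split; nra.
  exists 1%N; split; first by case=> //= _; rewrite /digits /= xlo.
  by rewrite /digits /= /negT xlo bx -lo (lt_gtF lohi).
- have [_] : neg_greedy_expansion beta (S_lo beta) (digits beta alpha (S_lo beta)).
    by apply: greedy; rewrite in_itv /=; apply/andP; split; nra.
  move/(_ (scons false (digits beta alpha (Mplus beta)))) => H.
  apply: (alt_lt_not_ge _ _ _ (H _)); last first.
    apply: neg_expansion_cons => //.
    rewrite subr0 (_ : _ * _ = Mplus beta); last by nra.
    by apply: expand; rewrite in_itv /=; apply/andP; split; nra.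
  by exists 0%N; split=> //; rewrite /digits /= lo.
Qed.
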